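(* Let $H$ be a separable Hilbert space (real or complex) with an orthonormal basis $\{b_n\}_{n\in\mathbb Z}$, let $\{u_n\}_{n\in\mathbb Z}$ be a sequence of nonzero scalars, let $U$ be the (possibly unbounded) bilateral weighted shift generated by $U b_n=\frac{u_{n+1}}{u_n}b_{n+1}$, and let $\widehat U=U\oplus (U^{*})^{-1}$ act in $\widehat H=H\oplus H$. Equip $\widehat H$ with the form $\{x\oplus y,x_1\oplus y_1\}=(x,y_1)+(y,x_1)$. Put $$L_{+}=\mathrm{span}\{\widehat U^N(b_0\oplus b_0): N\in\mathbb Z\},\qquad L_{-}=\mathrm{span}\{\widehat U^N(b_0\oplus -b_0): N\in\mathbb Z\}.$$ Then: (1) $\widehat U^{\pm1}L_{+}=L_{+}$; (2) $\widehat U^{\pm1}L_{-}=L_{-}$; (3) $b_N\oplus 0\in L_{+}+L_{-}$ and $0\oplus b_N\in L_{+}+L_{-}$ for all $N\in\mathbb Z$; (4) if $x\in\widehat H$ and $\{y,x\}=0$ for all $y\in L_{+}+L_{-}$, then $x=0$; (5) $\overline{L_{+}+L_{-}}=\widehat H$; (6) $\{x,y\}=0$ for all $x\in L_{+}$, $y\in L_{-}$; (7) $\{x,x\}>0$ for all $x\in L_{+}\setminus\{0\}$; (8) $\{x,x\}<0$ for all $x\in L_{-}\setminus\{0\}$; (9) $L_{+}\cap L_{-}=\{0\}$. Moreover: (6') $\{x,y\}=0$ for all $x\in\overline{L_{+}}$, $y\in\overline{L_{-}}$; (7') $\{x,x\}>0$ for all $x\in\overline{L_{+}}\setminus\{0\}$;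 (8') $\{x,x\}<0$ for all $x\in\overline{L_{-}}\setminus\{0\}$; (9') $\overline{L_{+}}\cap\overline{L_{-}}=\{0\}$. If in addition $U$ and $U^{-1}$ are bounded, then (1') $\widehat U^{\pm1}\overline{L_{+}}=\overline{L_{+}}$; (2') $\widehat U^{\pm1}\overline{L_{-}}=\overline{L_{-}}$.
   Context: Sesquilinear forms, including the Hilbert scalar product $(\cdot,\cdot)$, are linear in the second argument and conjugate-linear in the first. The operator $U$ is the closure of the linear operator defined on $\mathrm{span}\{b_n\}$ by $b_n\mapsto \frac{u_{n+1}}{u_n}b_{n+1}$; it is closed, densely defined, injective, with dense range. For $N\in\mathbb Z$, $U^N$ and $(U^* )^{-N}$ are the closed operators generated in the same way by $U^N b_n=\frac{u_{n+N}}{u_n}b_{n+N}$ and $(U^* )^{-N}b_n=\frac{\overline{u_n}}{\overline{u_{n+N}}}b_{n+N}$, and $\widehat U^N=U^N\oplus (U^* )^{-N}$. Thus $\widehat U^N(b_0\oplus \pm b_0)=U^Nb_0\oplus \pm (U^* )^{-N}b_0$. Overline on a set denotes norm closure in $\widehat H$. *)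

(* Defs.v *)
From HB Require Import structures.
From mathcomp Require Import all_boot all_order all_algebra.
From mathcomp Require Import sesquilinear.
From mathcomp Require Import complex.
From mathcomp Require Import all_classical all_reals all_analysis.

Set Implicit Arguments.
Unset Strict Implicit.
Unset Printing Implicit Defensive.

Import Order.TTheory GRing.Theory Num.Theory.
Import numFieldNormedType.Exports.

Local Open Scope classical_set_scope.
Local Open Scope ring_scope.

Inductive scalars := RealScalars | ComplexScalars.

Definition scalar_field (R : realType) (s : scalars) : numFieldType :=
  match s with
  | RealScalars => R
  | ComplexScalars => R[i]%C
  end.

Definition sconj (R : realType) (s : scalars) :
    scalar_field R s -> scalar_field R s :=
  match s with
  | RealScalars => @idfun R
  | ComplexScalars => @conjc R
  end.

(* The library's dot forms are linear in the first argument and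
   conjugate-linear in the second; scal has the opposite convention. *)
Definition scal (K : numFieldType) (conj : K -> K) (H : lmodType K)
  (dot : {dot H for conj}) (x y : H) : K := dot y x.

Definition lspan (K : numFieldType) (V : lmodType K) (A : set V) : set V :=
  [set x | exists (n : nat) (c : 'I_n -> K) (v : 'I_n -> V),
     (forall i, A (v i)) /\ x = \sum_(i < n) c i *: v i].

Definition orthonormal_basis (K : numFieldType) (H : normedModType K)
    (ip : H -> H -> K) (b : int -> H) : Prop :=
  (forall m n, ip (b m) (b n) = (m == n)%:R) /\
  closure (lspan (range b)) = setT.

(* A possibly unbounded operator in V is represented by its graph, a subset
   of V * V. *)

Definition op_dom (V : Type) (G : set (V * V)) : set V :=
  [set x | exists y, G (x, y)].

Definition op_image (V : Type) (G : set (V * V)) (A : set V) : set V :=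
  [set y | exists2 x, A x & G (x, y)].

(* "G A = B", which presupposes that G is defined on all of A. *)
Definition op_maps_onto (V : Type) (G : set (V * V)) (A B : set V) : Prop :=
  A `<=` op_dom G /\ op_image G A = B.

Definition op_inv (V : Type) (G : set (V * V)) : set (V * V) :=
  [set p | G (p.2, p.1)].

(* (y, z) is in the graph of the adjoint of G when (y, G x) = (z, x) for all
   x in the domain of G. *)
Definition op_adjoint (K : numFieldType) (H : lmodType K) (ip : H -> H -> K)
    (G : set (H * H)) : set (H * H) :=
  [set p | forall x w, G (x, w) -> ip p.1 w = ip p.2 x].

(* In the topological notions below, H (+) H is the library's H * H, whose norm
   is the max of the component norms: it is equivalent to the Hilbert norm, so
   closures are the same. *)
Definition op_dsum (V W : Type) (S : set (V * V)) (T : set (W * W)) :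
    set ((V * W) * (V * W)) :=
  [set p | S (p.1.1, p.2.1) /\ T (p.1.2, p.2.2)].

(* For a closed densely defined operator this is the same as being everywhere
   defined and bounded. *)
Definition op_bounded (K : numFieldType) (H : normedModType K)
    (G : set (H * H)) : Prop :=
  exists M : K, forall x y, G (x, y) -> `|y| <= M * `|x|.

(* Closure of the linear operator defined on the span of the b n by
   b n |-> f n; the graph of the latter is the span of the pairs below. *)
Definition generated_op (K : numFieldType) (H : normedModType K)
    (b f : int -> H) : set (H * H) :=
  closure (lspan (range (fun n => (b n, f n)))).

(* U^N; for |N| >= 2 this need not be the literal composition power, which
   may fail to be closed. *)
Definition U_pow (K : numFieldType) (H : normedModType K)
    (b : int -> H) (u : int -> K) (N : int) : set (H * H) :=
  generated_op b (fun n => (u (n + N) / u n) *: b (n + N)).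

(* (U^* )^(-N) *)
Definition Uadj_negpow (K : numFieldType) (conj : K -> K)
    (H : normedModType K) (b : int -> H) (u : int -> K) (N : int) :
    set (H * H) :=
  generated_op b (fun n => (conj (u n) / conj (u (n + N))) *: b (n + N)).

Definition Uhat_pow (K : numFieldType) (conj : K -> K)
    (H : normedModType K) (b : int -> H) (u : int -> K) (N : int) :
    set ((H * H) * (H * H)) :=
  op_dsum (U_pow b u N) (Uadj_negpow conj b u N).

Definition U_op (K : numFieldType) (H : normedModType K)
    (b : int -> H) (u : int -> K) : set (H * H) :=
  generated_op b (fun n => (u (n + 1) / u n) *: b (n + 1)).

(* U (+) (U^* )^(-1), with the genuine adjoint and inverse. *)
Definition Uhat (K : numFieldType) (H : normedModType K)
    (ip : H -> H -> K) (b : int -> H) (u : int -> K) :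
    set ((H * H) * (H * H)) :=
  op_dsum (U_op b u) (op_inv (op_adjoint ip (U_op b u))).

Definition orbit_span (K : numFieldType) (conj : K -> K)
    (H : normedModType K) (b : int -> H) (u : int -> K) (v : H * H) :
    set (H * H) :=
  lspan [set q | exists N : int, Uhat_pow conj b u N (v, q)].

Definition L_plus (K : numFieldType) (conj : K -> K)
    (H : normedModType K) (b : int -> H) (u : int -> K) : set (H * H) :=
  orbit_span conj b u (b 0, b 0).

Definition L_minus (K : numFieldType) (conj : K -> K)
    (H : normedModType K) (b : int -> H) (u : int -> K) : set (H * H) :=
  orbit_span conj b u (b 0, - b 0).

Definition hat_form (K : numFieldType) (H : lmodType K) (ip : H -> H -> K)
    (p q : H * H) : K :=
  ip p.1 q.2 + ip p.2 q.1.

Definition set_sum (V : zmodType) (A B : set V) : set V :=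
  [set x + y | x in A & y in B].

(* Main.v *)
Require Import Defs.
From HB Require Import structures.
From mathcomp Require Import all_boot all_order all_algebra.
From mathcomp Require Import sesquilinear.
From mathcomp Require Import complex.
From mathcomp Require Import all_classical all_reals all_analysis.
From mathcomp Require Import ring.

(* Write g_N = U^N b_0 (+) sg (U^* )^(-N) b_0 with sg = 1 or -1; these vectors
   span L_sg, and {g_N, g_M} = 2 sg delta_(N,M).  Hence g_N |-> b_N extends to a
   linear map T on L_sg with {x, y} = 2 sg (T x, T y), and Cauchy-Schwarz bounds
   each coordinate of x by a multiple of sg {x, x}.  These bounds are closed
   conditions on x, so they persist on the closure of L_sg, where the vanishing
   of sg {x, x} therefore kills every coordinate of x.  The shift U^ maps g_N to
   g_(N+1); it is closed, and bounded in both directions when U and U^-1 are, so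
   it then maps the closure of L_sg onto itself. *)

Set Implicit Arguments.
Unset Strict Implicit.
Unset Printing Implicit Defensive.

Import Order.TTheory GRing.Theory Num.Theory.
Import numFieldNormedType.Exports.

Local Open Scope classical_set_scope.
Local Open Scope ring_scope.

(** * Linear spans, and spans of pairs as linear relations *)

Section LinearSpan.
Variables (K : numFieldType).

Definition linear_set (V : lmodType K) (S : set V) : Prop :=
  S 0 /\ forall a x y, S x -> S y -> S (a *: x + y).

(** The induction principle for spans: an identity is checked on the generators and shown to be
    preserved by [a *: x + y]. *)
Lemma lspan_min (V : lmodType K) (A S : set V) :
  linear_set S -> A `<=` S -> lspan A `<=` S.
Proof.
move=> [S0 Slin] AS x [n [c [v [Av ->]]]].
elim/big_ind: _ => //.
  by move=> y z Sy Sz; rewrite -(scale1r y); exact: Slin.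
by move=> i _; rewrite -(addr0 (_ *: _)); apply: Slin; [exact/AS/Av|].
Qed.

Lemma sub_lspan (V : lmodType K) (A : set V) : A `<=` lspan A.
Proof.
move=> x Ax; exists 1, (fun=> 1), (fun=> x); split=> //.
by rewrite big_ord1 scale1r.
Qed.

Lemma lspan_linear (V : lmodType K) (A : set V) : linear_set (lspan A).
Proof.
split; first by exists 0, (fun=> 0), (fun=> 0); split; [case|rewrite big_ord0].
move=> a x y [n [c [v [Av ->]]]] [m [d [w [Aw ->]]]].
exists (n + m)%N,
  (fun i => match fintype.split i with inl j => a * c j | inr j => d j end),
  (fun i => match fintype.split i with inl j => v j | inr j => w j end).
split; first by move=> i; case: (fintype.split i).
rewrite big_split_ord /= scaler_sumr; congr (_ + _); apply: eq_bigr => i _.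
  by rewrite (unsplitK (inl i)) scalerA.
by rewrite (unsplitK (inr i)).
Qed.

Lemma linear_setZ (V : lmodType K) (S : set V) a x :
  linear_set S -> S x -> S (a *: x).
Proof. by move=> [S0 Slin] Sx; rewrite -(addr0 (a *: x)); exact: Slin. Qed.

Lemma linear_setD (V : lmodType K) (S : set V) x y :
  linear_set S -> S x -> S y -> S (x + y).
Proof. by move=> [_ Slin] Sx Sy; rewrite -(scale1r x); exact: Slin. Qed.

Lemma linear_set_preimage (V W : lmodType K) (f : {linear V -> W}) (S : set W) :
  linear_set S -> linear_set (f @^-1` S).
Proof.
move=> [S0 Slin]; split; first by rewrite /preimage /= linear0.
by move=> a x y Sx Sy; rewrite /preimage /= linearP; exact: Slin.
Qed.

Variables (I : Type) (V W : lmodType K) (f : I -> V) (g : I -> W).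
Let graph := lspan (range (fun i => (f i, g i))).

Lemma lspan_graph_fst p : graph p -> lspan (range f) p.1.
Proof.
apply: (lspan_min (linear_set_preimage fst (lspan_linear _))) => _ [i _ <-].
by apply: sub_lspan; exists i.
Qed.

Lemma lspan_graph_snd p : graph p -> lspan (range g) p.2.
Proof.
apply: (lspan_min (linear_set_preimage snd (lspan_linear _))) => _ [i _ <-].
by apply: sub_lspan; exists i.
Qed.

Lemma lspan_graph_dom x : lspan (range f) x -> exists y, graph (x, y).
Proof.
have [G0 Glin] := lspan_linear (range (fun i => (f i, g i))).
apply: (@lspan_min _ _ [set x | exists y, graph (x, y)]); first split.
- by exists 0.
- by move=> a x1 x2 [y1 G1] [y2 G2]; exists (a *: y1 + y2); exact: Glin G1 G2.
- by move=> _ [i _ <-]; exists (g i); apply: sub_lspan; exists i.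
Qed.

Lemma lspan_graph_codom y : lspan (range g) y -> exists x, graph (x, y).
Proof.
have [G0 Glin] := lspan_linear (range (fun i => (f i, g i))).
apply: (@lspan_min _ _ [set y | exists x, graph (x, y)]); first split.
- by exists 0.
- by move=> a x1 x2 [y1 G1] [y2 G2]; exists (a *: y1 + y2); exact: Glin G1 G2.
- by move=> _ [i _ <-]; exists (f i); apply: sub_lspan; exists i.
Qed.

End LinearSpan.

(** * Closed conditions given by continuous functions *)

Section ClosedSets.
Variables (K : numFieldType).

Lemma closure_min (T : topologicalType) (A B : set T) :
  closed B -> A `<=` B -> closure A `<=` B.
Proof. by move=> cB AB; rewrite closureE; exact: smallest_sub. Qed.

Lemma closed_preimage (S T : topologicalType) (f : S -> T) (A : set T) :
  continuous f -> closed A -> closed (f @^-1` A).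
Proof. by move=> /continuous_closedP; exact. Qed.

Lemma closed_eqfun (T : topologicalType) (f g : T -> K) :
  continuous f -> continuous g -> closed [set x | f x = g x].
Proof.
move=> cf cg.
have -> : [set x | f x = g x] = (fun x => f x - g x) @^-1` [set 0].
  by apply/seteqP; split=> x /= => [->|/subr0_eq //]; rewrite subrr.
apply: closed_preimage; first by move=> x; apply: cvgB; [exact: cf|exact: cg].
exact/accessible_closed_set1/hausdorff_accessible/norm_hausdorff.
Qed.

(* The order of [K] is only partial, so nonnegativity is expressed as
   [`|z| = z]. *)
Lemma closed_lefun (T : topologicalType) (f g : T -> K) :
  continuous f -> continuous g -> closed [set x | f x <= g x].
Proof.
move=> cf cg.
have -> : [set x | f x <= g x] = [set x | `|g x - f x| = g x - f x].
  by apply/seteqP; split=> x /=; rewrite -subr_ge0 ger0_def => /eqP.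
have cgf : continuous (fun x => g x - f x).
  by move=> x; apply: cvgB; [exact: cg|exact: cf].
by apply: closed_eqfun => // x; apply: cvg_norm; exact: cgf.
Qed.

Lemma fst_continuous (S T : topologicalType) : continuous (@fst S T).
Proof. by move=> p; exact: cvg_fst. Qed.

Lemma snd_continuous (S T : topologicalType) : continuous (@snd S T).
Proof. by move=> p; exact: cvg_snd. Qed.

End ClosedSets.

(** * Extension of bounded linear relations to the closure of their domain *)

Section BoundedExtension.
Variables (K : numFieldType) (V W : normedModType K).

(** The constant in [op_bounded] is an arbitrary element of [K], possibly negative or not real; this
    replaces it by a nonnegative one. *)
Lemma le_normM (M a c : K) : 0 <= a -> 0 <= c -> a <= M * c -> a <= `|M| * c.
Proof.
move=> a0 c0 aMc; have /ger0_norm := le_trans a0 aMc.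
by rewrite normrM (ger0_norm c0) => ->.
Qed.

(** Completeness of [H * H], in the form [bounded_graph_extend] asks for. Balls of the product are
    products of balls, so both components of the filter are Cauchy. *)
Lemma prod_cauchy_cvg (H : completeNormedModType K)
    (F : set_system (H * H)) :
  ProperFilter F -> cauchy_ex F -> exists p : H * H, F --> p.
Proof.
move=> FF Fce.
have c1 : cvg (fst @ F).
  apply/cauchy_cvgP/cauchy_exP => e e0; have [p Fp] := Fce _ e0.
  by exists p.1; exact: (@filterS _ F _ _ _ (fun q pq => proj1 pq) Fp).
have c2 : cvg (snd @ F).
  apply/cauchy_cvgP/cauchy_exP => e e0; have [p Fp] := Fce _ e0.
  by exists p.2; exact: (@filterS _ F _ _ _ (fun q pq => proj2 pq) Fp).
exists (lim (fst @ F), lim (snd @ F)).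
move=> A /(cvg_pair c1 c2) FA.
by apply: (@filterS _ F _ _ _ _ FA) => -[].
Qed.

(* The values attained near [x] form a Cauchy filter. *)
Lemma bounded_graph_extend (D : set (V * W)) (M : K) :
  (forall F : set_system W, ProperFilter F -> cauchy_ex F ->
     exists y : W, F --> y) ->
  linear_set D ->
  (forall x y, D (x, y) -> `|y| <= M * `|x|) ->
  forall x, closure [set p.1 | p in D] x -> exists y, closure D (x, y).
Proof.
move=> Wc [D0 Dlin] DM x xD.
have {}DM p q : D p -> D q -> `|p.2 - q.2| <= `|M| * `|p.1 - q.1|.
  move=> Dp Dq.
  have Dpq : D (p.1 - q.1, p.2 - q.2).
    have := Dlin (-1) _ _ Dq Dp; rewrite scaleN1r addrC.
    by case: p {Dp} => ? ?; case: q {Dq}.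
  by apply: le_normM => //; exact: DM.
pose B e := [set p | D p /\ `|x - p.1| < e].
pose G := filter_from [set e : K | 0 < e] B.
have GF : ProperFilter G.
  apply: filter_from_proper.
    apply: filter_from_filter; first by exists 1; rewrite /= ltr01.
    move=> e1 e2 /= e10 e20.
    (* Positive elements of [K] are real, hence comparable, although the order of [K] is partial. *)
    have [le12|/ltW le21] := real_leP (gtr0_real e10) (gtr0_real e20).
      exists e1 => // p [Dp xp]; split; split=> //.
      exact: lt_le_trans le12.
    exists e2 => // p [Dp xp]; split; split=> //.
    exact: lt_le_trans le21.
  move=> e e0; have [p [[q Dq <-] xq]] := xD _ (nbhsx_ballx x e e0).
  by exists q; split=> //; rewrite -ball_normE in xq.
have M1 : 0 < `|M| + 1 by rewrite ltr_wpDl.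
have cG : cauchy_ex (snd @ G).
  move=> e e0.
  (* Two points this close to [x] are within [e / (|M| + 1)] of each other, so their values are
     within [e]; adding 1 covers [M = 0]. *)
  have e'0 : 0 < e / (2 * (`|M| + 1)) by rewrite divr_gt0 // mulr_gt0.
  have Ge : G (B (e / (2 * (`|M| + 1)))) by exists (e / (2 * (`|M| + 1))).
  have [p [Dp xp]] := filter_ex Ge.
  exists p.2; exists (e / (2 * (`|M| + 1))) => // q [Dq xq].
  rewrite -ball_normE /= (le_lt_trans (DM _ _ Dp Dq)) //.
  have pq : `|p.1 - q.1| < e / (`|M| + 1).
    rewrite -(subrKA x) (le_lt_trans (ler_normD _ _)) //.
    rewrite [X in _ < X](_ : _ = e / (2 * (`|M| + 1)) + e / (2 * (`|M| + 1))).
      by rewrite ltrD // distrC.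
    by field; rewrite gt_eqF.
  rewrite (le_lt_trans (ler_wpM2l _ (ltW pq))) // mulrCA gtr_pMr //.
  by rewrite ltr_pdivrMr // mul1r ltrDl.
have [y Gy] := Wc _ _ cG.
exists y => A [[A1 A2] [/= A1x A2y] A12A].
have /nbhs_ballP[e e0 eA1] := A1x.
have Ge : G (B e) by exists e.
have [p [[Dp xp] pA2]] := filter_ex (filterI Ge (Gy _ A2y)).
exists p; split=> //; apply: A12A; split=> //=.
by apply: eA1; rewrite -ball_normE.
Qed.

End BoundedExtension.

(** * Cauchy-Schwarz and continuity of the forms *)

Section InnerProduct.
Variables (K : numFieldType) (conj : {rmorphism K -> K}).
Variable H : completeNormedModType K.
Variable dot : {dot H for conj}.
Hypothesis conj_norm : forall z : K, z * conj z = `|z| ^+ 2.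
Hypothesis dot_norm : forall x : H, `|x| ^+ 2 = dot x x.

Local Notation ip := (scal dot).
Local Notation form := (hat_form ip).

Lemma scalDr x y z : ip x (y + z) = ip x y + ip x z.
Proof. exact: linearDl. Qed.

Lemma scalDl x y z : ip (x + y) z = ip x z + ip y z.
Proof. exact: linearDr. Qed.

Lemma scalZr a x y : ip x (a *: y) = a * ip x y.
Proof. exact: linearZl_LR. Qed.

Lemma scalZl a x y : ip (a *: x) y = conj a * ip x y.
Proof. exact: linearZr_LR. Qed.

Lemma scal0r x : ip x 0 = 0. Proof. exact: linear0l. Qed.

Lemma scal0l x : ip 0 x = 0. Proof. exact: linear0r. Qed.

Lemma conj_scal x y : conj (ip x y) = ip y x.
Proof. by rewrite /scal [RHS]hermitian_subproof expr0 mul1r. Qed.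

Lemma scalxx x : ip x x = `|x| ^+ 2. Proof. by rewrite dot_norm. Qed.

(** Split [y] into [t *: x] and a part [z] orthogonal to [x], and apply Pythagoras. *)
Lemma cauchy_schwarz x y : `|ip x y| <= `|x| * `|y|.
Proof.
have [->|x0] := eqVneq x 0; first by rewrite scal0l !normr0 mul0r.
have n0 : 0 < `|x| ^+ 2 by rewrite exprn_gt0 // normr_gt0.
pose t := ip x y / `|x| ^+ 2.
have [z yz xz] : exists2 z, y = z + t *: x & ip x z = 0.
  exists (y - t *: x); first by rewrite subrK.
  by rewrite -scaleNr scalDr scalZr scalxx mulNr divfK ?subrr // gt_eqF.
have zx : ip z x = 0 by rewrite -conj_scal xz rmorph0.
have yE : `|y| ^+ 2 = `|z| ^+ 2 + `|ip x y| ^+ 2 / `|x| ^+ 2.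
  rewrite [in LHS]yz -!scalxx !(scalDr, scalDl, scalZr, scalZl) xz zx.
  rewrite !mulr0 add0r addr0 mulrA conj_norm !scalxx.
  rewrite /t normrM normfV exprMn (ger0_norm (ltW n0)).
  by field; rewrite normr_eq0.
rewrite -(@ler_pXn2r _ 2) ?nnegrE ?mulr_ge0 // exprMn yE mulrC.
by rewrite mulrDl divfK ?gt_eqF // lerDr mulr_ge0 // exprn_ge0.
Qed.

Lemma scal_continuous (T : topologicalType) (f g : T -> H) :
  continuous f -> continuous g -> continuous (fun x => ip (f x) (g x)).
Proof.
move=> cf cg x.
(* [h] dominates the increment of [ip (f z) (g z)] and tends to 0. *)
pose h z := `|f z - f x| * `|g z| + `|f x| * `|g z - g x|.
have h0 : h z @[z --> x] --> (0 : K).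
  have fx : f z - f x @[z --> x] --> f x - f x.
    by apply: cvgB; [exact: cf|exact: cvg_cst].
  have gx : g z - g x @[z --> x] --> g x - g x.
    by apply: cvgB; [exact: cg|exact: cvg_cst].
  have -> : (0 : K) = `|f x - f x| * `|g x| + `|f x| * `|g x - g x|.
    by rewrite !subrr !normr0 mul0r mulr0 addr0.
  apply: cvgD; apply: cvgM; try exact: cvg_cst; try exact: cvg_norm.
  exact: (cvg_norm (cg x)).
apply/cvgrPdist_lt => e e0.
have : \forall z \near x, `|0 - h z| < e by exact: cvgr_dist_lt.
apply: filterS => z; apply: le_lt_trans.
rewrite sub0r normrN distrC.
have -> : ip (f z) (g z) - ip (f x) (g x) =
    ip (f z - f x) (g z) + ip (f x) (g z - g x).
  rewrite -(scaleN1r (f x)) -(scaleN1r (g x)) scalDl scalDr scalZl scalZr.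
  by rewrite rmorphN1; ring.
rewrite [X in _ <= X]ger0_norm ?addr_ge0 ?mulr_ge0 //.
by rewrite (le_trans (ler_normD _ _)) // lerD // cauchy_schwarz.
Qed.

Lemma hat_form_continuous (T : topologicalType) (f g : T -> H * H) :
  continuous f -> continuous g -> continuous (fun x => form (f x) (g x)).
Proof.
move=> cf cg x; rewrite /hat_form.
have cf1 : continuous (fst \o f).
  by move=> z; apply: continuous_comp; [exact: cf|exact: fst_continuous].
have cf2 : continuous (snd \o f).
  by move=> z; apply: continuous_comp; [exact: cf|exact: snd_continuous].
have cg1 : continuous (fst \o g).
  by move=> z; apply: continuous_comp; [exact: cg|exact: fst_continuous].
have cg2 : continuous (snd \o g).
  by move=> z; apply: continuous_comp; [exact: cg|exact: snd_continuous].
apply: cvgD; first exact: (scal_continuous cf1 cg2).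
exact: (scal_continuous cf2 cg1).
Qed.

Lemma linear_set_ip (V : lmodType K) (f g : {linear V -> H}) (x y : H) a :
  linear_set [set v | ip x (f v) = a * ip y (g v)].
Proof.
split=> [|c v w]; first by rewrite /= !linear0 !scal0r mulr0.
rewrite /= !linearP !scalDr !scalZr => -> ->; ring.
Qed.

(** * Coordinates in the basis, and closed weighted shifts *)

Variable b : int -> H.
Hypothesis basis_b : orthonormal_basis ip b.

Let scalb m n : ip (b m) (b n) = (m == n)%:R.
Proof. by case: basis_b. Qed.

Lemma basis_norm n : `|b n| = 1.
Proof.
by apply/eqP; rewrite -(@pexpr_eq1 _ _ 2) // -scalxx scalb eqxx.
Qed.

(** Orthogonality to [x] is a closed linear condition that holds on the basis, hence everywhere, in
    particular at [x] itself. *)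
Lemma basis_eq0 x : (forall n, ip (b n) x = 0) -> x = 0.
Proof.
move=> bx; have : closure (lspan (range b)) x by case: basis_b => _ ->.
have cl : closed [set y | ip x y = 0].
  apply: closed_eqfun; last exact: cst_continuous.
  by apply: scal_continuous; [exact: cst_continuous|move=> ?; exact: cvg_id].
move=> /(closure_min cl) xx.
apply/eqP; rewrite -normr_eq0 -sqrf_eq0 -scalxx; apply/eqP/xx.
apply: lspan_min; first split=> [|a y z] /=; first by rewrite scal0r.
  by rewrite scalDr scalZr => -> ->; rewrite mulr0 addr0.
by move=> _ [n _ <-] /=; rewrite -conj_scal bx rmorph0.
Qed.

Lemma basis_inj x y : (forall n, ip (b n) x = ip (b n) y) -> x = y.
Proof.
move=> xy; apply/subr0_eq/basis_eq0 => n.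
by rewrite -scaleN1r scalDr scalZr xy mulN1r subrr.
Qed.

(** The relation is linear and closed, so it passes from the generating pairs to the closure of
    their span. It makes the closure single-valued, and injective for nonzero weights. *)
Lemma generated_op_coef w N x y :
  generated_op b (fun n => w n *: b (n + N)) (x, y) ->
  forall n, ip (b (n + N)) y = w n * ip (b n) x.
Proof.
move=> xy n; move: xy; apply: (@closure_min _ _
  [set p : H * H | ip (b (n + N)) p.2 = w n * ip (b n) p.1]).
  apply: closed_eqfun => [|p].
    by apply: scal_continuous; [exact: cst_continuous|exact: snd_continuous].
  apply: cvgM; first exact: cvg_cst.
  by apply: scal_continuous; [exact: cst_continuous|exact: fst_continuous].
apply: lspan_min; first exact: linear_set_ip.
move=> _ [m _ <-] /=; rewrite scalZr !scalb (inj_eq (addIr N)).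
by case: eqVneq => [->|]; rewrite ?mulr0.
Qed.

Lemma generated_op_functional w N x y z :
  generated_op b (fun n => w n *: b (n + N)) (x, y) ->
  generated_op b (fun n => w n *: b (n + N)) (x, z) -> y = z.
Proof.
move=> /generated_op_coef xy /generated_op_coef xz.
by apply: basis_inj => n; rewrite -(subrK N n) xy xz.
Qed.

Lemma generated_op_injective w N x y z : (forall n, w n != 0) ->
  generated_op b (fun n => w n *: b (n + N)) (x, z) ->
  generated_op b (fun n => w n *: b (n + N)) (y, z) -> x = y.
Proof.
move=> w0 /generated_op_coef xz /generated_op_coef yz.
by apply: basis_inj => n; apply: (mulfI (w0 n)); rewrite -xz -yz.
Qed.

(** Every scalar is a value of [ip], and hermitian symmetry applied twice restores that value. *)
Lemma conj_involutive z : conj (conj z) = z.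
Proof.
have -> : z = ip (b 0) (z *: b 0) by rewrite scalZr scalb eqxx mulr1.
by rewrite !conj_scal.
Qed.

(** * The orbit of the starting vector under the powers of the shift *)

Variable u : int -> K.
Hypothesis u_neq0 : forall n, u n != 0.

Let conj_u n : conj (u n) != 0. Proof. by rewrite fmorph_eq0. Qed.

(** The vector g_N, written out in the basis. *)
Definition shift_orbit (sg : K) (N : int) : H * H :=
  ((u N / u 0) *: b N, (sg * (conj (u 0) / conj (u N))) *: b N).

(** The pair with index 0 of each generated operator puts g_N in the orbit; single-valuedness of the
    closed graphs excludes any other value. *)
Lemma orbit_spanE sg :
  orbit_span conj b u (b 0, sg *: b 0) = lspan (range (shift_orbit sg)).
Proof.
rewrite /orbit_span; congr lspan; apply/seteqP.
split=> [q [N [/= Uq Vq]]|_ [N _ <-]].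
  exists N => //; rewrite (surjective_pairing q) /shift_orbit; congr pair.
    apply: (generated_op_functional _ Uq); apply/subset_closure/sub_lspan.
    by exists 0 => //=; rewrite add0r.
  apply: (generated_op_functional _ Vq); apply: subset_closure.
  rewrite -scalerA; apply: (linear_setZ sg (lspan_linear _) (x := (_, _))).
  by apply: sub_lspan; exists 0 => //=; rewrite add0r.
exists N; split => /=.
  by apply/subset_closure/sub_lspan; exists 0 => //=; rewrite add0r.
rewrite -scalerA; apply: subset_closure.
apply: (linear_setZ sg (lspan_linear _) (x := (_, _))).
by apply/sub_lspan; exists 0 => //=; rewrite add0r.
Qed.

(** * The operator [Uh]: single-valued, injective, closed *)

Local Notation U := (U_op b u).
Local Notation U0 := (range (fun n => (b n, (u (n + 1) / u n) *: b (n + 1)))).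
Local Notation Uh := (Uhat ip b u).

Lemma adjoint_coef y z : op_adjoint ip U (y, z) ->
  forall n, (u (n + 1) / u n) * ip y (b (n + 1)) = ip z (b n).
Proof.
move=> yz n; rewrite -scalZr; apply: yz.
by apply/subset_closure/sub_lspan; exists n.
Qed.

Let ratio_neq0 n : u (n + 1) / u n != 0.
Proof. by rewrite mulf_neq0 ?invr_eq0. Qed.

(** In the second summand the adjoint relation makes each coordinate of one vector a nonzero
    multiple of a shifted coordinate of the other, so either vector determines the other. *)
Lemma Uhat_functional x y z : Uh (x, y) -> Uh (x, z) -> y = z.
Proof.
case: x y z => [x1 x2] [y1 y2] [z1 z2] [/= U1 V1] [/= U2 V2].
congr pair; first exact: generated_op_functional U1 U2.
apply: basis_inj => n; rewrite -(conj_scal y2) -(conj_scal z2); congr (conj _).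
apply: (mulfI (ratio_neq0 (n - 1))).
by have := adjoint_coef V1 (n - 1); rewrite -(adjoint_coef V2) subrK.
Qed.

Lemma Uhat_injective x y z : Uh (x, z) -> Uh (y, z) -> x = y.
Proof.
case: x y z => [x1 x2] [y1 y2] [z1 z2] [/= U1 V1] [/= U2 V2].
congr pair; first exact: (generated_op_injective ratio_neq0 U1 U2).
apply: basis_inj => n; rewrite -(conj_scal x2) -(conj_scal y2); congr (conj _).
by rewrite -(adjoint_coef V1) -(adjoint_coef V2).
Qed.

Lemma adjoint_linear (G : set (H * H)) : linear_set (op_adjoint ip G).
Proof.
split=> [x w _|a p q Gp Gq x w xw] /=; first by rewrite !scal0l.
by rewrite !scalDl !scalZl (Gp _ _ xw) (Gq _ _ xw).
Qed.

Lemma adjoint_closed (G : set (H * H)) : closed (op_adjoint ip G).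
Proof.
move=> p cp x w xw; move: p cp.
apply: closure_min => [|p Gp]; last exact: Gp xw.
apply: closed_eqfun; apply: scal_continuous; try exact: cst_continuous.
  exact: fst_continuous.
exact: snd_continuous.
Qed.

Lemma Uhat_closed : closed Uh.
Proof.
have -> : Uh = (fun p => (p.1.1, p.2.1)) @^-1` U `&`
  (fun p => (p.2.2, p.1.2)) @^-1` op_adjoint ip U by [].
apply: closedI; apply: closed_preimage.
- move=> p; apply: cvg_pair.
    exact: (continuous_comp (@fst_continuous _ _ p) (@fst_continuous _ _ p.1)).
  exact: (continuous_comp (@snd_continuous _ _ p) (@fst_continuous _ _ p.2)).
- exact: closed_closure.
- move=> p; apply: cvg_pair.
    exact: (continuous_comp (@snd_continuous _ _ p) (@snd_continuous _ _ p.2)).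
  exact: (continuous_comp (@fst_continuous _ _ p) (@snd_continuous _ _ p.1)).
- exact: adjoint_closed.
Qed.

(** * Invariance of the orbit spans under [Uh] and its inverse *)

Definition shift_step (sg : K) : set ((H * H) * (H * H)) :=
  lspan (range (fun N => (shift_orbit sg N, shift_orbit sg (N + 1)))).

Lemma shift_step_Uhat sg : shift_step sg `<=` Uh.
Proof.
move=> p pD; split.
  apply: subset_closure; move: p pD.
  apply: lspan_min => [|_ [N _ <-]] /=.
    have [S0 Slin] := lspan_linear U0.
    by split=> // a p q Sp Sq; exact: (Slin a _ _ Sp Sq).
  rewrite (_ : _ *: b (N + 1) =
      (u N / u 0) *: ((u (N + 1) / u N) *: b (N + 1))).
    apply: (linear_setZ _ (lspan_linear _) (x := (_, _))).
    by apply: sub_lspan; exists N.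
  by rewrite scalerA; congr (_ *: _); field; rewrite !u_neq0.
move: p pD; apply: lspan_min => [|_ [N _ <-]] /=.
  have [S0 Slin] := adjoint_linear U.
  by split=> // a p q Sp Sq; exact: (Slin a _ _ Sp Sq).
(* The adjoint relation is tested on an arbitrary pair of [U]; its coordinates at [N] and [N + 1]
   reduce it to a scalar identity. *)
move=> x w /= /generated_op_coef xw.
rewrite !scalZl xw !rmorphM !fmorphV !conj_involutive.
by field; rewrite !u_neq0.
Qed.

Lemma shift_step_codom sg y : lspan (range (shift_orbit sg)) y ->
  exists x, shift_step sg (x, y).
Proof.
move=> Ly; apply: lspan_graph_codom; move: y Ly.
apply: lspan_min; first exact: lspan_linear.
by move=> _ [N _ <-]; apply: sub_lspan; exists (N - 1) => //; rewrite subrK.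
Qed.

Lemma shift_step_sub sg p : shift_step sg p ->
  lspan (range (shift_orbit sg)) p.1 /\ lspan (range (shift_orbit sg)) p.2.
Proof.
move=> Dp; split; first exact: lspan_graph_fst Dp.
move: (lspan_graph_snd Dp); apply: lspan_min; first exact: lspan_linear.
by move=> _ [N _ <-]; apply: sub_lspan; exists (N + 1).
Qed.

(** One image and one preimage in [A] suffice for each point, because [Uh] is single-valued and
    injective. *)
Lemma Uhat_maps_onto (A : set (H * H)) :
  (forall x, A x -> exists2 y, A y & Uh (x, y)) ->
  (forall y, A y -> exists2 x, A x & Uh (x, y)) ->
  op_maps_onto Uh A A /\ op_maps_onto (op_inv Uh) A A.
Proof.
move=> Af Ab; split; split.
- by move=> x /Af[y _ xy]; exists y.
- apply/seteqP; split=> [y [x /Af[z Az xz] xy]|y /Ab[x Ax xy]].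
    by rewrite (Uhat_functional xy xz).
  by exists x.
- by move=> y /Ab[x _ xy]; exists x.
- apply/seteqP; split=> [x [y /Ab[z Az zy] xy]|x /Af[y Ay xy]].
    by have -> : x = z by exact: Uhat_injective xy zy.
  by exists y.
Qed.

Lemma Uhat_orbit sg (L := lspan (range (shift_orbit sg))) :
  op_maps_onto Uh L L /\ op_maps_onto (op_inv Uh) L L.
Proof.
apply: Uhat_maps_onto => x Lx.
  have [y xy] := lspan_graph_dom (fun N => shift_orbit sg (N + 1)) Lx.
  by exists y; [case: (shift_step_sub xy)|exact: shift_step_Uhat xy].
have [y xy] := shift_step_codom Lx.
by exists y; [case: (shift_step_sub xy)|exact: shift_step_Uhat xy].
Qed.

(** * The bounded case: invariance of the closures *)

Lemma op_dom_bounded (D : set (H * H)) (M : K) :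
  linear_set D -> (forall x y, D (x, y) -> `|y| <= M * `|x|) ->
  lspan (range b) `<=` [set p.1 | p in D] ->
  forall x, exists y, closure D (x, y).
Proof.
move=> Dlin DM bD x; apply: (bounded_graph_extend _ Dlin DM).
  by move=> F FF /cauchy_exP/cauchy_cvgP cF; exists (lim F).
have : closure (lspan (range b)) x by case: basis_b => _ ->.
exact: closureS.
Qed.

Lemma U_total : op_bounded U -> forall x, exists y, U (x, y).
Proof.
move=> [M UM]; apply: (op_dom_bounded (M := M)) => [|x y|].
- exact: lspan_linear.
- by move=> xy; apply/UM/subset_closure.
move=> x /(lspan_graph_dom (fun n => (u (n + 1) / u n) *: b (n + 1)))[y xy].
by exists (x, y).
Qed.

Lemma U_onto : op_bounded (op_inv U) -> forall y, exists x, U (x, y).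
Proof.
move=> [M UM] y.
pose D := lspan U0.
(* Surjectivity is totality of the transposed graph, so the extension argument is run on the
   transpose and swapped back. *)
pose D' : set (H * H) := [set p | D (p.2, p.1)].
have swapc : continuous (fun p : H * H => (p.2, p.1)).
  by move=> p; apply: cvg_pair; [exact: snd_continuous|exact: fst_continuous].
have [x yx] : exists x, closure D' (y, x).
  apply: (op_dom_bounded (M := M)) => [|x z xz|z zb].
  - have [D0 Dlin] := lspan_linear U0.
    by split=> // a p q Sp Sq; exact: (Dlin a _ _ Sp Sq).
  - by apply: UM; apply: subset_closure.
  have [|x xz] := lspan_graph_codom b
    (g := fun n => (u (n + 1) / u n) *: b (n + 1)) (y := z);
    last by exists (z, x).
  move: z zb; apply: lspan_min; first exact: lspan_linear.
  move=> _ [n _ <-].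
  have -> : b n = (u (n - 1 + 1) / u (n - 1))^-1 *:
      ((u (n - 1 + 1) / u (n - 1)) *: b (n - 1 + 1)).
    by rewrite scalerA mulVf // scale1r subrK.
  by apply/(linear_setZ _ (lspan_linear _))/sub_lspan; exists (n - 1).
exists x; move: yx; apply: (@closure_min _ _ ((fun p => (p.2, p.1)) @^-1` U)).
  by apply: closed_preimage => //; exact: closed_closure.
by move=> [z t] Dp; exact: (@subset_closure _ D (t, z) Dp).
Qed.

(** The norm of a pair is a maximum in a partially ordered field; norms are real, so the two
    components are comparable. *)
Lemma prod_norm_bound (M1 M2 : K) (p q : H * H) :
  `|q.1| <= M1 * `|p.1| -> `|q.2| <= M2 * `|p.2| ->
  `|q| <= (`|M1| + `|M2|) * `|p|.
Proof.
move=> /le_normM q1 /le_normM q2.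
have cmp (x y : H) : (`|x| >=< `|y|)%O by exact: real_comparable.
rewrite !prod_normE comparable_ge_max //; apply/andP; split.
  rewrite (le_trans (q1 _ _)) // ler_pM ?lerDl //.
  by rewrite comparable_le_max // lexx.
rewrite (le_trans (q2 _ _)) // ler_pM ?lerDr //.
by rewrite comparable_le_max // lexx orbT.
Qed.

(** Writing [y] as the image of [x] gives (y, y) = (z, x), which is at most |z| |M| |y|; divide by
    |y|. *)
Lemma adjoint_bounded (M : K) : (forall y, exists x, U (x, y)) ->
  (forall x y, U (x, y) -> `|x| <= M * `|y|) ->
  forall y z, op_adjoint ip U (y, z) -> `|y| <= `|M| * `|z|.
Proof.
move=> Uonto UM y z yz; have [x xy] := Uonto y.
have [->|y0] := eqVneq y 0; first by rewrite normr0 mulr_ge0.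
rewrite -(@ler_pM2r _ `|y|) ?normr_gt0 // -expr2.
have zx := yz _ _ xy; rewrite /= scalxx in zx.
rewrite -(ger0_norm (exprn_ge0 2 (normr_ge0 y))) zx.
rewrite (le_trans (cauchy_schwarz _ _)) // mulrAC mulrC ler_wpM2r //.
by apply: le_normM => //; exact: UM.
Qed.

(** Here (z, z) = (y, w) with [w] the image of [z] under [U]. *)
Lemma adjoint_inv_bounded (M : K) : (forall x, exists y, U (x, y)) ->
  (forall x y, U (x, y) -> `|y| <= M * `|x|) ->
  forall y z, op_adjoint ip U (y, z) -> `|z| <= `|M| * `|y|.
Proof.
move=> Utot UM y z yz; have [w zw] := Utot z.
have [->|z0] := eqVneq z 0; first by rewrite normr0 mulr_ge0.
rewrite -(@ler_pM2r _ `|z|) ?normr_gt0 // -expr2.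
have yw := yz _ _ zw; rewrite /= scalxx in yw.
rewrite -(ger0_norm (exprn_ge0 2 (normr_ge0 z))) -yw.
rewrite (le_trans (cauchy_schwarz _ _)) // mulrAC mulrC ler_wpM2r //.
by apply: le_normM => //; exact: UM.
Qed.

Lemma Uhat_bounded : op_bounded U -> op_bounded (op_inv U) ->
  op_bounded Uh /\ op_bounded (op_inv Uh).
Proof.
move=> bU bV; have Utot := U_total bU; have Uonto := U_onto bV.
move: bU bV => [M UM] [M' UM'].
have UM'' x y : U (x, y) -> `|x| <= M' * `|y| by move=> xy; exact: UM'.
split.
  exists (`|M| + `| `|M'| |) => p q [/UM pq1 /(adjoint_bounded Uonto UM'') pq2].
  exact: prod_norm_bound.
exists (`|M'| + `| `|M| |) => p q.
move=> [/UM'' pq1 /(adjoint_inv_bounded Utot UM) pq2].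
exact: prod_norm_bound.
Qed.

(** [shift_step] is bounded both ways, so its closure relates each point of [L] to an image and a
    preimage; that closure stays in [L] on both sides, and in [Uh] because [Uh] is closed. *)
Lemma Uhat_closure_orbit sg (L := closure (lspan (range (shift_orbit sg)))) :
  op_bounded U -> op_bounded (op_inv U) ->
  op_maps_onto Uh L L /\ op_maps_onto (op_inv Uh) L L.
Proof.
move=> bU bV; have [[M UM] [M' UM']] := Uhat_bounded bU bV.
have clD : closure (shift_step sg) `<=` Uh.
  by apply: closure_min; [exact: Uhat_closed|exact: shift_step_Uhat].
have clL p : closure (shift_step sg) p -> L p.1 /\ L p.2.
  apply: (@closure_min _ _ ((fst @^-1` L) `&` (snd @^-1` L))).
    apply: closedI; apply: closed_preimage; try exact: closed_closure.
      exact: fst_continuous.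
    exact: snd_continuous.
  by move=> q /shift_step_sub[q1 q2]; split; exact: subset_closure.
have Dlin : linear_set (shift_step sg) by exact: lspan_linear.
apply: Uhat_maps_onto => x Lx.
  have [|y xy] := bounded_graph_extend (x := x) (@prod_cauchy_cvg _ H) Dlin
    (fun x y xy => UM x y (shift_step_Uhat xy)).
    apply: closureS Lx => y.
    move=> /(lspan_graph_dom (fun N => shift_orbit sg (N + 1)))[z yz].
    by exists (y, z).
  by exists y; [case: (clL _ xy)|exact: clD].
pose D' := [set p | shift_step sg (p.2, p.1)].
have D'lin : linear_set D'.
  by split=> [|a p q Dp Dq]; [exact: Dlin.1|exact: (Dlin.2 a _ _ Dp Dq)].
have [|y xy] := bounded_graph_extend (x := x) (@prod_cauchy_cvg _ H) D'lin
    (fun x y xy => UM' x y (shift_step_Uhat xy)).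
  by apply: closureS Lx => y /shift_step_codom[z zy]; exists (y, z).
have yx : closure (shift_step sg) (y, x).
  move: xy; apply: (@closure_min _ D'
    ((fun p => (p.2, p.1)) @^-1` closure (shift_step sg))).
    apply: closed_preimage; last exact: closed_closure.
    move=> p.
    exact: (cvg_pair (@snd_continuous _ _ p) (@fst_continuous _ _ p)).
  by move=> [z t] Dp; exact: (@subset_closure _ (shift_step sg) (t, z) Dp).
by exists y; [case: (clL _ yx)|exact: clD].
Qed.

(** * The indefinite form on the orbit spans and their closures *)

Lemma formPr a p q r : form p (a *: q + r) = a * form p q + form p r.
Proof. by rewrite /hat_form !scalDr !scalZr; ring. Qed.

Lemma formPl a p q r : form (a *: p + q) r = conj a * form p r + form q r.
Proof. by rewrite /hat_form !scalDl !scalZl; ring. Qed.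

Lemma form0r p : form p 0 = 0.
Proof. by rewrite /hat_form !scal0r addr0. Qed.

Lemma form0l p : form 0 p = 0.
Proof. by rewrite /hat_form !scal0l addr0. Qed.

(* [shift_orbit sg N |-> b N] carries the form to a multiple of the scalar
   product. *)
Definition orbit_coord (sg : K) : set ((H * H) * H) :=
  lspan (range (fun N => (shift_orbit sg N, b N))).

(** For [N = M] the weights cancel. The factor [tau + conj sg] is 2 sg for equal signs and 0 for
    opposite ones, so one computation serves definiteness and orthogonality. *)
Lemma form_orbit sg tau N M :
  form (shift_orbit sg N) (shift_orbit tau M) =
  (tau + conj sg) * ip (b N) (b M).
Proof.
rewrite /hat_form /= !(scalZl, scalZr) !scalb.
case: eqVneq => [->|_]; last by rewrite !mulr0 addr0.
rewrite !rmorphM !fmorphV !conj_involutive.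
by field; rewrite !u_neq0 !conj_u.
Qed.

Lemma form_orbit_coord sg tau p q : orbit_coord sg p -> orbit_coord tau q ->
  form p.1 q.1 = (tau + conj sg) * ip p.2 q.2.
Proof.
move=> pL qL; move: p pL; apply: (@lspan_min _ _ _ [set p |
  form p.1 q.1 = (tau + conj sg) * ip p.2 q.2]); first split => [|a x y] /=.
- by rewrite form0l scal0l mulr0.
- by rewrite formPl scalDl scalZl => -> ->; ring.
move=> _ [N _ <-] /=; move: q qL; apply: (@lspan_min _ _ _ [set q |
  form _ q.1 = (tau + conj sg) * ip _ q.2]); first split => [|a x y] /=.
- by rewrite form0r scal0r mulr0.
- by rewrite formPr scalDr scalZr => -> ->; ring.
by move=> _ [M _ <-]; exact: form_orbit.
Qed.

Lemma orbit_coord_dom sg x : lspan (range (shift_orbit sg)) x ->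
  exists t, orbit_coord sg (x, t).
Proof. exact: lspan_graph_dom. Qed.

Lemma orbit_coord1 sg p k : orbit_coord sg p ->
  ip (b k) p.1.1 = (u k / u 0) * ip (b k) p.2.
Proof.
move: p; apply: (@lspan_min _ _ _ [set p | _ = _ * ip (b k) p.2]);
  first split => [|a x y] /=.
- by rewrite !scal0r mulr0.
- by rewrite !scalDr !scalZr => -> ->; ring.
move=> _ [N _ <-] /=; rewrite scalZr scalb.
by case: eqVneq => [->|_]; rewrite ?mulr0.
Qed.

Lemma orbit_coord2 sg p k : orbit_coord sg p ->
  ip (b k) p.1.2 = (sg * (conj (u 0) / conj (u k))) * ip (b k) p.2.
Proof.
move: p; apply: (@lspan_min _ _ _ [set p | _ = _ * ip (b k) p.2]);
  first split => [|a x y] /=.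
- by rewrite !scal0r mulr0.
- by rewrite !scalDr !scalZr => -> ->; ring.
move=> _ [N _ <-] /=; rewrite scalZr scalb.
by case: eqVneq => [->|_]; rewrite ?mulr0.
Qed.

Lemma form_orthogonal sg tau x y : tau + conj sg = 0 ->
  lspan (range (shift_orbit sg)) x -> lspan (range (shift_orbit tau)) y ->
  form x y = 0.
Proof.
move=> st /orbit_coord_dom[t xt] /orbit_coord_dom[r yr].
by rewrite (form_orbit_coord xt yr) st mul0r.
Qed.

(** Continuity is used one argument at a time, with the other held fixed. *)
Lemma form_closure_orthogonal sg tau x y : tau + conj sg = 0 ->
  closure (lspan (range (shift_orbit sg))) x ->
  closure (lspan (range (shift_orbit tau))) y -> form x y = 0.
Proof.
move=> st xL yL; move: x xL; apply: (@closure_min _ _ [set x | form x y = 0]).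
  apply: closed_eqfun; last exact: cst_continuous.
  apply: hat_form_continuous; last exact: cst_continuous.
  by move=> ?; exact: cvg_id.
move=> x xL /=; move: y yL; apply: (@closure_min _ _ [set y | form x y = 0]).
  apply: closed_eqfun; last exact: cst_continuous.
  apply: hat_form_continuous; first exact: cst_continuous.
  by move=> ?; exact: cvg_id.
by move=> y yL; exact: form_orthogonal xL yL.
Qed.

Section Definite.
Variable sg : K.
Hypothesis sg1 : sg = 1 \/ sg = -1.

Let sg_sq : sg * (sg + conj sg) = 2.
Proof. by case: sg1 => ->; rewrite ?rmorphN1 ?rmorph1; ring. Qed.

Let sg_norm : `|sg| = 1.
Proof. by case: sg1 => ->; rewrite ?normrN normr1. Qed.

(* The inequalities are closed conditions, so they survive in the closure,
   where [orbit_coord] is no longer available. *)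
Lemma form_orbit_ge x k : closure (lspan (range (shift_orbit sg))) x ->
  2 * `|ip (b k) x.1| ^+ 2 <= `|u k / u 0| ^+ 2 * (sg * form x x) /\
  2 * `|ip (b k) x.2| ^+ 2 <=
    `|conj (u 0) / conj (u k)| ^+ 2 * (sg * form x x).
Proof.
have cform : continuous (fun x : H * H => sg * form x x).
  move=> y; apply: cvgM; first exact: cvg_cst.
  by apply: (@hat_form_continuous _ id id) => ?; exact: cvg_id.
have cip (f : H * H -> H) : continuous f ->
    continuous (fun x => 2 * `|ip (b k) (f x)| ^+ 2).
  move=> cf y; apply: cvgM; first exact: cvg_cst.
  apply: cvgM; apply: cvg_norm;
    by apply: scal_continuous => //; exact: cst_continuous.
move: x; apply: (@closure_min _ _ [set x | _ /\ _]).
  apply: closedI; apply: closed_lefun.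
  - by apply: cip; exact: fst_continuous.
  - by move=> y; apply: cvgM; [exact: cvg_cst|exact: cform].
  - by apply: cip; exact: snd_continuous.
  - by move=> y; apply: cvgM; [exact: cvg_cst|exact: cform].
move=> x /orbit_coord_dom[t xt] /=.
rewrite (orbit_coord1 k xt) (orbit_coord2 k xt) (form_orbit_coord xt xt) /=.
(* Now [sg * form x x] has become [2 * ip t t], and both bounds reduce to [tk]. *)
rewrite (mulrA sg) sg_sq; move: (u k / u 0) (conj (u 0) / conj (u k)) => c d.
rewrite !normrM sg_norm mul1r scalxx.
have tk : `|ip (b k) t| ^+ 2 <= `|t| ^+ 2.
  by rewrite ler_pXn2r ?nnegrE // -[leRHS]mul1r -(basis_norm k) cauchy_schwarz.
by split; rewrite exprMn mulrCA ler_wpM2l ?exprn_ge0 // ler_wpM2l.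
Qed.

Lemma form_orbit_gt0 x : closure (lspan (range (shift_orbit sg))) x ->
  x != 0 -> 0 < sg * form x x.
Proof.
move=> xL x0; have xk k := form_orbit_ge k xL.
have ge0 : 0 <= sg * form x x.
  (* At index 0 the weight is 1, so the bound gives nonnegativity directly. *)
  have [+ _] := xk 0; rewrite divff // normr1 expr1n mul1r; apply: le_trans.
  by rewrite mulr_ge0 // exprn_ge0.
rewrite lt_def ge0 andbT; apply: contra x0 => /eqP fx0; apply/eqP.
have z0 (z : K) : 2 * `|z| ^+ 2 <= 0 -> z = 0.
  rewrite pmulr_rle0 // => zle0; apply/eqP.
  by rewrite -normr_eq0 -sqrf_eq0 eq_le zle0 exprn_ge0.
rewrite (surjective_pairing x); congr pair; apply: basis_eq0 => k; apply: z0.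
  by have [] := xk k; rewrite fx0 mulr0.
by have [] := xk k; rewrite fx0 !mulr0.
Qed.

End Definite.

(** * The sum and the intersection of the two orbit spans *)

Lemma linear_set_sum (V : lmodType K) (A B : set V) :
  linear_set A -> linear_set B -> linear_set (set_sum A B).
Proof.
move=> [A0 Alin] [B0 Blin]; split.
  by exists 0 => //; exists 0 => //; rewrite addr0.
move=> a _ _ [x1 Ax1 [x2 Bx2 <-]] [y1 Ay1 [y2 By2 <-]].
exists (a *: x1 + y1); first exact: Alin.
exists (a *: x2 + y2); first exact: Blin.
by rewrite scalerDr addrACA.
Qed.

Local Notation L sg := (lspan (range (shift_orbit sg))).

(** The vectors g_N for the two signs differ only in the sign of the second component, so their sum
    and difference isolate one component each; [c] normalizes it. *)
Lemma basis_in_sum N :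
  set_sum (L 1) (L (-1)) (b N, 0) /\ set_sum (L 1) (L (-1)) (0, b N).
Proof.
have mem sg c : L sg (c *: shift_orbit sg N).
  by apply/(linear_setZ _ (lspan_linear _))/sub_lspan; exists N.
have uN0 : u N / u 0 != 0 by rewrite mulf_neq0 ?invr_eq0.
have cN0 : conj (u 0) / conj (u N) != 0 by rewrite mulf_neq0 ?invr_eq0.
split.
  pose c := (2 * (u N / u 0))^-1.
  exists (c *: shift_orbit 1 N) => //; exists (c *: shift_orbit (-1) N) => //.
  congr pair => /=; rewrite !scalerA -scalerDl.
    rewrite -[RHS]scale1r; congr (_ *: _); rewrite /c.
    by field; rewrite !u_neq0.
  by rewrite mul1r mulN1r mulrN subrr scale0r.
pose c := (2 * (conj (u 0) / conj (u N)))^-1.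
exists (c *: shift_orbit 1 N) => //; exists (- c *: shift_orbit (-1) N) => //.
congr pair => /=; rewrite !scalerA -scalerDl.
  by rewrite mulNr subrr scale0r.
rewrite -[RHS]scale1r; congr (_ *: _); rewrite /c mul1r mulN1r mulrNN.
by field; rewrite !conj_u.
Qed.

(** The form pairs opposite components: testing against [(0, b n)] reads off the first component of
    [x], and [(b n, 0)] the second. *)
Lemma sum_form_eq0 x :
  (forall y, set_sum (L 1) (L (-1)) y -> form y x = 0) -> x = 0.
Proof.
move=> x0; rewrite (surjective_pairing x); congr pair; apply: basis_eq0 => n.
  by have := x0 _ (basis_in_sum n).2; rewrite /hat_form /= scal0l add0r.
by have := x0 _ (basis_in_sum n).1; rewrite /hat_form /= scal0l addr0.
Qed.

Lemma sum_dense : closure (set_sum (L 1) (L (-1))) = setT.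
Proof.
have Slin := linear_set_sum (lspan_linear (range (shift_orbit 1)))
  (lspan_linear (range (shift_orbit (-1)))).
have S1 x : lspan (range b) x -> set_sum (L 1) (L (-1)) (x, 0).
  apply: (@lspan_min _ _ _ [set x | set_sum (L 1) (L (-1)) (x, 0)]).
    split=> [|a y z Sy Sz]; first exact: Slin.1.
    rewrite /= (_ : (_, _) = a *: (y, 0) + (z, 0)); first exact: Slin.2.
    by congr pair; rewrite /= scaler0 addr0.
  by move=> _ [n _ <-]; exact: (basis_in_sum n).1.
have S2 x : lspan (range b) x -> set_sum (L 1) (L (-1)) (0, x).
  apply: (@lspan_min _ _ _ [set x | set_sum (L 1) (L (-1)) (0, x)]).
    split=> [|a y z Sy Sz]; first exact: Slin.1.
    rewrite /= (_ : (_, _) = a *: (0, y) + (0, z)); first exact: Slin.2.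
    by congr pair; rewrite /= scaler0 addr0.
  by move=> _ [n _ <-]; exact: (basis_in_sum n).2.
have dense x : closure (lspan (range b)) x by case: basis_b => _ ->.
apply/seteqP; split=> // -[x y] _ A [[A1 A2] [/= A1x A2y] A12].
have [x' [bx' A1x']] := dense x _ A1x; have [y' [by' A2y']] := dense y _ A2y.
exists (x', y'); split; last exact: A12.
have := linear_setD Slin (S1 _ bx') (S2 _ by').
rewrite [X in set_sum _ _ X](_ : _ = (x', y')) //.
by congr pair; rewrite /= ?addr0 ?add0r.
Qed.

(** On a nonzero common vector the form would be both positive and negative. *)
Lemma closure_orbit_disjoint : closure (L 1) `&` closure (L (-1)) = [set 0].
Proof.
apply/seteqP; split=> [x [xp xm]|_ ->]; last first.
  by split; apply: subset_closure; exact: (lspan_linear _).1.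
apply/eqP; apply: contraT => x0.
have := form_orbit_gt0 (or_introl erefl) xp x0.
have := form_orbit_gt0 (or_intror erefl) xm x0.
by rewrite mul1r mulN1r oppr_gt0 => /lt_trans h /h; rewrite ltxx.
Qed.

End InnerProduct.

(** * Real and complex conjugation treated uniformly, and the theorem *)

HB.instance Definition _ (R : realType) (s : scalars) :=
  GRing.isZmodMorphism.Build (scalar_field R s) (scalar_field R s)
    (@sconj R s) (match s return zmod_morphism (@sconj R s) with
      | RealScalars => fun _ _ => erefl
      | ComplexScalars => @raddfB _ _ (@conjc R)
      end).

HB.instance Definition _ (R : realType) (s : scalars) :=
  GRing.isMonoidMorphism.Build (scalar_field R s) (scalar_field R s)
    (@sconj R s) (match s return monoid_morphism (@sconj R s) with
      | RealScalars => (erefl, fun _ _ => erefl)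
      | ComplexScalars => (@rmorph1 _ _ (@conjc R), @rmorphM _ _ (@conjc R))
      end).

Lemma sconj_norm (R : realType) (s : scalars) (z : scalar_field R s) :
  z * sconj z = `|z| ^+ 2.
Proof.
case: s z => z; last by rewrite sqr_normc.
by rewrite real_normK ?num_real // expr2.
Qed.

Theorem theorem2p1 (R : realType) (s : scalars)
  (H : completeNormedModType (scalar_field R s))
  (dot : {dot H for @sconj R s})
  (dot_norm : forall x : H, `|x| ^+ 2 = dot x x)
  (b : int -> H) (basis_b : orthonormal_basis (scal dot) b)
  (u : int -> scalar_field R s) (u_neq0 : forall n, u n != 0) :
  let form := hat_form (scal dot) in
  let U := U_op b u in
  let Uh := Uhat (scal dot) b u in
  let Lp := L_plus (@sconj R s) b u in
  let Lm := L_minus (@sconj R s) b u in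
  ((* 1 *) op_maps_onto Uh Lp Lp /\ op_maps_onto (op_inv Uh) Lp Lp) /\
  ((* 2 *) op_maps_onto Uh Lm Lm /\ op_maps_onto (op_inv Uh) Lm Lm) /\
  ((* 3 *) forall N : int,
     set_sum Lp Lm (b N, 0) /\ set_sum Lp Lm (0, b N)) /\
  ((* 4 *) forall x : H * H,
     (forall y, set_sum Lp Lm y -> form y x = 0) -> x = 0) /\
  ((* 5 *) closure (set_sum Lp Lm) = setT) /\
  ((* 6 *) forall x y, Lp x -> Lm y -> form x y = 0) /\
  ((* 7 *) forall x, Lp x -> x != 0 -> 0 < form x x) /\
  ((* 8 *) forall x, Lm x -> x != 0 -> form x x < 0) /\
  ((* 9 *) Lp `&` Lm = [set 0]) /\
  ((* 6' *) forall x y, closure Lp x -> closure Lm y -> form x y = 0) /\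
  ((* 7' *) forall x, closure Lp x -> x != 0 -> 0 < form x x) /\
  ((* 8' *) forall x, closure Lm x -> x != 0 -> form x x < 0) /\
  ((* 9' *) closure Lp `&` closure Lm = [set 0]) /\
  (op_bounded U -> op_bounded (op_inv U) ->
    ((* 1' *) op_maps_onto Uh (closure Lp) (closure Lp) /\
       op_maps_onto (op_inv Uh) (closure Lp) (closure Lp)) /\
    ((* 2' *) op_maps_onto Uh (closure Lm) (closure Lm) /\
       op_maps_onto (op_inv Uh) (closure Lm) (closure Lm))).
Proof.
pose cn := @sconj_norm R s.
have EP := orbit_spanE cn dot_norm basis_b u 1.
have EM := orbit_spanE cn dot_norm basis_b u (-1).
(* Turns [1 *: b 0] and [-1 *: b 0] into the starting vectors of [L_plus] and [L_minus]. *)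
rewrite scale1r in EP; rewrite scaleN1r in EM.
move=> form U Uh Lp Lm; rewrite {}/Lp {}/Lm {}/form {}/Uh {}/U /L_plus /L_minus.
rewrite {}EP {}EM.
have orth0 : -1 + sconj 1 = 0 :> scalar_field R s by rewrite rmorph1 addNr.
have gt0 := form_orbit_gt0 cn dot_norm basis_b u_neq0.
have pos x := gt0 _ (or_introl erefl) x.
have neg x := gt0 _ (or_intror erefl) x.
have disj := closure_orbit_disjoint cn dot_norm basis_b u_neq0.
have pos' x : closure (lspan (range (shift_orbit (@sconj R s) b u 1))) x ->
    x != 0 -> 0 < hat_form (scal dot) x x.
  by move=> xL x0; have := pos x xL x0; rewrite mul1r.
have neg' x : closure (lspan (range (shift_orbit (@sconj R s) b u (-1)))) x ->
    x != 0 -> hat_form (scal dot) x x < 0.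
  by move=> xL x0; have := neg x xL x0; rewrite mulN1r oppr_gt0.
split; first exact: (Uhat_orbit cn dot_norm basis_b u_neq0).
split; first exact: (Uhat_orbit cn dot_norm basis_b u_neq0).
split; first by move=> N; exact: (basis_in_sum (@sconj R s) b u_neq0).
split; first by move=> x; exact: (sum_form_eq0 cn dot_norm basis_b u_neq0).
split; first exact: (sum_dense basis_b u_neq0).
split; first by move=> x y; exact: (form_orthogonal basis_b u_neq0 orth0).
split; first by move=> x /subset_closure; exact: pos'.
split; first by move=> x /subset_closure; exact: neg'.
split.
  apply/seteqP; split=> [x [xp xm]|_ ->].
    by rewrite -disj; split; exact: subset_closure.
  by split; exact: (lspan_linear _).1.
split.
  move=> x y.
  exact: (form_closure_orthogonal cn dot_norm basis_b u_neq0 orth0).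
do 3![split=> //].
by move=> bU bV; split; exact: (Uhat_closure_orbit cn dot_norm basis_b u_neq0).
Qed.
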